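(* Let $P,Q$ be probability measures on $\mathbb{R}^d$ supported on a countable set $E\subset\mathbb{R}^d$. Let $H$ be a linear subspace of $\mathbb{R}^d$ such that $H^\perp\cap(E-E)=\{0\}$. Then $$d_{TV}(P,Q)=d_{TV}(P_H,Q_H).$$ In particular, $P_H=Q_H$ implies $P=Q$.
   Context: Probability measures on $\mathbb{R}^d$ are Borel; $P$ being supported on the countable set $E$ means $P(E)=1$ (and likewise for $Q$). $E-E:=\{x-y: x,y\in E\}$. For probability measures $P,Q$ on a measurable space $(S,\mathcal{A})$, the total variation distance is $d_{TV}(P,Q):=\sup_{A\in\mathcal{A}}|P(A)-Q(A)|$. For a linear subspace $H$ of $\mathbb{R}^d$, $H^\perp$ denotes its orthogonal complement and $\pi_H:\mathbb{R}^d\to H$ the orthogonal projection onto $H$. For a Borel probability measure $P$ on $\mathbb{R}^d$, its projection $P_H$ onto $H$ is the Borel probability measure on $H$ given by $P_H(B):=P(\pi_H^{-1}(B))$ for Borel $B\subset H$. *)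

(* Defs.v *)
From HB Require Import structures.
From mathcomp Require Import all_boot all_order all_algebra.
From mathcomp Require Import all_classical all_reals all_analysis.

Set Implicit Arguments.
Unset Strict Implicit.
Unset Printing Implicit Defensive.

Import Order.TTheory GRing.Theory Num.Theory.
Import numFieldNormedType.Exports.

Local Open Scope classical_set_scope.
Local Open Scope ring_scope.

Notation borel T := (g_sigma_algebraType (@open T)).

Definition dTV {d} {T : measurableType d} {R : realType}
    (P Q : probability T R) : \bar R :=
  ereal_sup [set `|P A - Q A|%E | A in measurable].

(* A subspace H, as a space in its own right, is [subvs_of H] with the topology
   induced by 'rV[R]_d. *)
HB.instance Definition _ {R : realType} {d : nat} (H : {vspace 'rV[R]_d}) :=
  Topological.copy (subvs_of H)
    (initial_topology (vsval : subvs_of H -> 'rV[R]_d)).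
HB.instance Definition _ {R : realType} {d : nat} (H : {vspace 'rV[R]_d}) :=
  isPointed.Build (subvs_of H) 0.

Section euclidean.
Context {R : realType} {d : nat}.

Definition dotv (u v : 'rV[R]_d) : R := \sum_i u 0 i * v 0 i.

Let dotv_bilinear : bilinear_for (GRing.Scale.Law.clone _ _ ( *%R) _)
  (GRing.Scale.Law.clone _ _ (idfun \; *%R) _) dotv.
Proof.
have -> : dotv = form_of_matrix idfun 1%:M.
  apply/funext => u; apply/funext => v.
  rewrite /form_of_matrix mulmx1 /= trace_mx11 mxE.
  by apply: eq_bigr => i _; rewrite !mxE.
exact: form_of_matrix_is_bilinear.
Qed.
HB.instance Definition _ :=
  bilinear_isBilinear.Build R _ _ _ _ _ dotv dotv_bilinear.

Let dotv_sym u v : dotv u v = (-1) ^+ false * idfun (dotv v u).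
Proof. by rewrite expr0 mul1r; apply: eq_bigr => i _; rewrite mulrC. Qed.
HB.instance Definition _ :=
  isHermitianSesquilinear.Build _ _ _ _ dotv dotv_sym.

Lemma dotv_eq0 (u : 'rV[R]_d) : dotv u u = 0 -> u = 0.
Proof.
move=> /eqP; rewrite psumr_eq0 => [|i _]; last by rewrite -expr2 sqr_ge0.
move=> /allP u0; apply/rowP => i; rewrite mxE; apply/eqP.
by have := u0 i (mem_index_enum i); rewrite /= mulf_eq0 orbb.
Qed.

Definition perp (H : {vspace 'rV[R]_d}) : {vspace 'rV[R]_d} := orthov dotv H.

Variable H : {vspace 'rV[R]_d}.

Lemma mem_perpP x : reflect (forall y, y \in H -> dotv x y = 0) (x \in perp H).
Proof. exact: mem_orthovP. Qed.

Lemma capv_perp : (H :&: perp H = 0)%VS.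
Proof.
apply/eqP; rewrite -subv0; apply/subvP => x; rewrite memv_cap memv0.
by move=> /andP[xH /mem_perpP/(_ _ xH)/dotv_eq0 ->].
Qed.

Lemma addv_perp : (H + perp H = fullv)%VS.
Proof.
pose B := \matrix_(i < d, j < \dim H) (vbasis H)`_j 0 i.
pose f := linfun (mulmxr B : 'rV[R]_d -> 'rV[R]_(\dim H)).
have kerB : (lker f <= perp H)%VS.
  apply/subvP => x; rewrite memv_ker lfunE /= => /eqP xB0.
  apply/mem_perpP => y /coord_vbasis ->.
  rewrite linear_sumr big1//= => j _; rewrite linearZr_LR /=.
  have /rowP/(_ j) := xB0; rewrite !mxE => xBj.
  rewrite [dotv _ _](_ : _ = 0) ?mulr0// -[RHS]xBj.
  by apply: eq_bigr => i _; rewrite mxE.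
apply/eqP; rewrite eqEdim subvf /=.
rewrite dimv_disjoint_sum ?capv_perp//.
rewrite -(limg_ker_dim f fullv).
rewrite capfv addnC leq_add ?dimvS//.
by rewrite (leq_trans (dimvS (subvf _)))// dimvf /dim /= mul1n.
Qed.

(* [daddv_pi H (perp H)] is the projection onto H along [perp H]; it is
   meaningful by [capv_perp] and [addv_perp]. *)
Definition orthoproj (x : 'rV[R]_d) : subvs_of H :=
  Subvs (memv_pi H (perp H) x).

Lemma orthoproj_perp x : x - vsval (orthoproj x) \in perp H.
Proof.
have /(daddv_pi_add capv_perp) E : x \in (H + perp H)%VS.
  by rewrite addv_perp memvf.
by rewrite -{1}E /= addrAC subrr add0r memv_pi.
Qed.

Lemma continuous_orthoproj : continuous orthoproj.
Proof.
apply: continuous_comp_initial.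
suff E : vsval \o orthoproj =
    (fun x : 'rV[R]_d => \sum_j x 0 j *: daddv_pi H (perp H) (delta_mx 0 j)).
  rewrite [X in continuous X]E; apply: continuous_big => [|j _ x].
    exact: add_continuous.
  have xj : (fun y : 'rV[R]_d => y 0 j) y @[y --> x] --> x 0 j.
    exact: coord_continuous.
  exact: (cvgZr_tmp xj).
apply/funext => x.
rewrite /= {1}(row_sum_delta x) linear_sum; apply: eq_bigr => j _.
by rewrite linearZ.
Qed.

Lemma measurable_orthoproj :
  measurable_fun [set: borel 'rV[R]_d]
    (orthoproj : borel 'rV[R]_d -> borel (subvs_of H)).
Proof.
apply: (@measurability _ _ (borel 'rV[R]_d) (borel (subvs_of H)) setT orthoproj
  (@open (subvs_of H))) => // _ [U oU <-].
rewrite setTI; apply: sub_sigma_algebra.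
by have /continuousP := continuous_orthoproj; exact.
Qed.
HB.instance Definition _ := isMeasurableFun.Build _ _ _ _
  (orthoproj : borel 'rV[R]_d -> borel (subvs_of H))
  measurable_orthoproj.

Definition proj_prob (P : probability (borel 'rV[R]_d) R) :
    probability (borel (subvs_of H)) R :=
  distribution P (orthoproj : borel 'rV[R]_d -> borel (subvs_of H)).

Lemma proj_probE (P : probability (borel 'rV[R]_d) R) (B : set (subvs_of H)) :
  proj_prob P B = P (orthoproj @^-1` B).
Proof. by []. Qed.

End euclidean.

(* Main.v *)
Require Import Defs.
From mathcomp Require Import all_boot all_order all_algebra.
From mathcomp Require Import all_classical all_reals all_analysis.

Import Order.TTheory GRing.Theory Num.Theory.
Import numFieldNormedType.Exports.

Local Open Scope classical_set_scope.
Local Open Scope ring_scope.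

(** Two points of [E] with the same projection onto [H] differ by an element of
    [H^\perp], hence coincide: the projection [f] is injective on [E]. For an
    event [A], the set [B := f @` (A `&` E)] is an event, because it is
    countable and singletons are closed, and its pullback meets [E] exactly in
    [A `&` E]. So [P A = P_H B] and [Q A = Q_H B] with one and the same [B]
    ([exists_event_image]). Conversely every event [B] of the subspace has the
    probabilities of its pullback. Hence the pairs [(P A, Q A)] and the
    pairs [(P_H B, Q_H B)] run through the same set, and both conclusions
    follow, because total variation distance and equality of measures depend
    only on that set of pairs. *)

Lemma eq_probability_on_support (d : measure_display) (T : measurableType d)
    (R : realType) (P : probability T R) (E A B : set T) :
  measurable E -> measurable A -> measurable B -> P E = 1%E ->
  A `&` E = B `&` E -> P A = P B.
Proof.
move=> mE mA mB PE AB.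
have PEC : P (~` E) = 0%E by rewrite probability_setC// PE subee.
have PI C : measurable C -> P C = P (C `&` E).
  move=> mC; rewrite [LHS](measureDI P mC mE) setDE.
  rewrite [X in (X + _)%E](subset_measure0 (B := ~` E)) ?add0e//.
  - exact: measurableI mC (measurableC mE).
  - exact: measurableC.
by rewrite (PI A)// (PI B)// AB.
Qed.

Section injective_on_support.
Context (d1 d2 : measure_display) (T : measurableType d1)
  (U : measurableType d2) (R : realType) (f : {mfun T >-> U}) (E : set T).
Hypotheses (countableE : countable E) (measurableE : measurable E).
Hypothesis measurable_set1U : forall y : U, measurable [set y].
Hypothesis injf : set_inj E f.

(** The event [B] is chosen independently of the measure: this is what lets it
    serve [P] and [Q] simultaneously. *)
Lemma exists_event_image (A : set T) : measurable A ->
  exists2 B : set U, measurable B &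
    forall P : probability T R, P E = 1%E -> P A = distribution P f B.
Proof.
move=> mA; have mB : measurable (f @` (A `&` E)).
  apply: countable_measurable => //.
  apply: sub_countable (card_image_le _ _) _.
  exact: sub_countable (subset_card_le (@subIsetr _ A E)) countableE.
exists (f @` (A `&` E)) => // P PE.
apply: (@eq_probability_on_support _ _ _ P E) => //.
  by rewrite -[X in measurable X]setTI; exact: measurable_funP.
apply/seteqP; split => [x [Ax Ex]|x [[y [Ay Ey] fyx] Ex]]; split => //.
  by exists x.
by rewrite -(injf _ _ _ _ fyx) ?inE.
Qed.

Lemma dTV_distribution (P Q : probability T R) : P E = 1%E -> Q E = 1%E ->
  dTV P Q = dTV (distribution P f) (distribution Q f).
Proof.
move=> PE QE; congr ereal_sup; apply/seteqP; split => _ [A mA <-].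
  have [B mB eqB] := exists_event_image A mA.
  by exists B => //; rewrite (eqB P PE) (eqB Q QE).
exists (f @^-1` A) => //.
by rewrite -[X in measurable X]setTI; exact: measurable_funP.
Qed.

Lemma distribution_inj (P Q : probability T R) : P E = 1%E -> Q E = 1%E ->
  (forall B, measurable B -> distribution P f B = distribution Q f B) ->
  forall A, measurable A -> P A = Q A.
Proof.
move=> PE QE eqPQ A mA; have [B mB eqB] := exists_event_image A mA.
by rewrite (eqB P PE) (eqB Q QE); exact: eqPQ.
Qed.

End injective_on_support.

Lemma closed_measurable_borel (T : ptopologicalType) (A : set T) :
  closed A -> measurable (A : set (borel T)).
Proof.
move=> cA; rewrite -[A]setCK; apply: measurableC.
by apply: sub_sigma_algebra; exact: closed_openC.
Qed.

Lemma measurable_set1_rV (R : realType) (d : nat) (x : 'rV[R]_d) :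
  measurable ([set x] : set (borel 'rV[R]_d)).
Proof.
apply: closed_measurable_borel; apply: accessible_closed_set1.
exact/hausdorff_accessible/norm_hausdorff.
Qed.

(** The topology of the subspace is pulled back along the injection [vsval], so
    its singletons are preimages of singletons of the ambient space. *)
Lemma measurable_set1_subvs (R : realType) (d : nat) (H : {vspace 'rV[R]_d})
    (y : subvs_of H) : measurable ([set y] : set (borel (subvs_of H))).
Proof.
apply: closed_measurable_borel.
have -> : [set y] = vsval @^-1` [set vsval y].
  by apply/seteqP; split => [x ->//|x /= /val_inj].
apply: closed_comp => [x _|]; first exact: initial_continuous.
apply: accessible_closed_set1; exact/hausdorff_accessible/norm_hausdorff.
Qed.

Lemma orthoproj_inj_on (R : realType) (d : nat) (E : set 'rV[R]_d)
    (H : {vspace 'rV[R]_d}) :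
  [set` perp H] `&` [set x - y | x in E & y in E] `<=` [set 0] ->
  set_inj E (orthoproj H).
Proof.
move=> HE x y; rewrite !inE => Ex Ey fxy.
apply/eqP; rewrite -subr_eq0; apply/eqP/HE; split; last first.
  by exists x => //; exists y.
(* [x - y] is the difference of the components of [x] and [y] in [perp H], as
   their components in [H] agree. *)
rewrite /= -(subrKA (vsval (orthoproj H x))) {2}fxy -(opprB y) rpredB//.
  exact: orthoproj_perp.
exact: orthoproj_perp.
Qed.

(* Measures are total functions whose values on non-measurable sets are
   arbitrary, so equality of measures is equality on measurable sets. *)
Theorem proposition2p3 (R : realType) (d : nat)
    (P Q : probability (borel 'rV[R]_d) R)
    (E : set 'rV[R]_d) (H : {vspace 'rV[R]_d}) :
  countable E -> P E = 1%E -> Q E = 1%E ->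
  [set` perp H] `&` [set x - y | x in E & y in E] = [set 0] ->
  dTV P Q = dTV (proj_prob H P) (proj_prob H Q) /\
  ((forall B : set (borel (subvs_of H)), measurable B ->
      proj_prob H P B = proj_prob H Q B) ->
   forall A : set (borel 'rV[R]_d), measurable A -> P A = Q A).
Proof.
move=> cE PE QE HE.
have mE : measurable (E : set (borel 'rV[R]_d)).
  by apply: countable_measurable => // x; exact: measurable_set1_rV.
have mU := @measurable_set1_subvs R d H.
have injE : set_inj E (orthoproj H) by apply: orthoproj_inj_on; rewrite HE.
pose f : {mfun borel 'rV[R]_d >-> borel (subvs_of H)} :=
  (orthoproj H : borel 'rV[R]_d -> borel (subvs_of H)).
split; first exact: (@dTV_distribution _ _ _ _ _ f E cE mE mU injE P Q PE QE).
exact: (@distribution_inj _ _ _ _ _ f E cE mE mU injE P Q PE QE).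
Qed.
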